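(* Let $\mu$ be a probability measure on the unit circle $\partial\mathbb{D}=\{z\in\mathbb{C}:|z|=1\}$ whose support is an infinite set, let $0<\gamma<1$, and let $\zeta=e^{i\omega}\in\partial\mathbb{D}$. Let $\nu$ be the probability measure on $\partial\mathbb{D}$ obtained by adding a point mass at $\zeta$ to $\mu$ as follows: $$d\nu=(1-\gamma)\,d\mu+\gamma\,\delta_{\omega},$$ where $\delta_\omega$ denotes the unit point mass at $\zeta=e^{i\omega}$. Then for every integer $n\ge 0$ the $n$-th Verblunsky coefficient of $\nu$ is $$\alpha_n(d\nu)=\alpha_n+\frac{(1-|\alpha_n|^2)^{1/2}}{(1-\gamma)\gamma^{-1}+K_n(\zeta)}\;\overline{\varphi_{n+1}(\zeta)}\,\varphi_n^*(\zeta),$$ where $$K_n(\zeta)=\sum_{j=0}^{n}|\varphi_j(\zeta)|^2,$$ and $\alpha_n=\alpha_n(d\mu)$, $\varphi_j=\varphi_j(\cdot,d\mu)$, $\varphi_n^*=\varphi_n^*(\cdot,d\mu)$ are the objects associated with $\mu$.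
   Context: For a probability measure $\rho$ on $\partial\mathbb{D}$ with infinite support, put $\langle f,g\rangle_{d\rho}=\int_{\partial\mathbb{D}}\overline{f(e^{i\theta})}\,g(e^{i\theta})\,d\rho(\theta)$ and $\|f\|_{d\rho}=\langle f,f\rangle_{d\rho}^{1/2}$. Let $\Phi_n(z)=\Phi_n(z,d\rho)$, $n\ge0$, be the monic orthogonal polynomials: $\Phi_n$ is the monic polynomial of degree $n$ that is orthogonal to $1,z,\dots,z^{n-1}$ in $L^2(\partial\mathbb{D},d\rho)$. The normalized (orthonormal) polynomials are $\varphi_n(z)=\varphi_n(z,d\rho)=\Phi_n(z)/\|\Phi_n\|_{d\rho}$. The reversed polynomials are $\Phi_n^*(z)=z^n\,\overline{\Phi_n(1/\overline{z})}$ and $\varphi_n^*(z)=\Phi_n^*(z)/\|\Phi_n\|_{d\rho}$. The Verblunsky coefficients $\alpha_n=\alpha_n(d\rho)$, $n\ge0$, are defined by the Szegő recursion $\Phi_{n+1}(z)=z\Phi_n(z)-\overline{\alpha_n}\,\Phi_n^*(z)$; equivalently, $\alpha_n=-\overline{\Phi_{n+1}(0)}$. *)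

(* Defs.v *)
From HB Require Import structures.
From mathcomp Require Import all_boot all_order all_algebra.
From mathcomp Require Import complex.
From mathcomp Require Import all_classical all_reals all_analysis.

Set Implicit Arguments.
Unset Strict Implicit.
Unset Printing Implicit Defensive.

Import Order.TTheory GRing.Theory Num.Theory.
Import numFieldNormedType.Exports.

Local Open Scope classical_set_scope.
Local Open Scope ring_scope.

(* complex_scope stays closed: there [z^*] would be [conjc z], whereas here it
   is [Num.conj z], from the numClosedFieldType structure of R[i]. *)

(* The unit circle as a subtype of the plane. [R[i]^o] is R[i] with the topology
   of its norm; R[i] itself has no canonical topology. *)
Definition circle (R : realType) : Type := [set z : R[i]^o | `|z| = 1].

Definition cval (R : realType) (z : circle R) : R[i] := set_val z.

Lemma normr_expi (R : realType) (t : R) : `|(cos t +i* sin t)%C| = 1.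
Proof. by rewrite normc_def /= cos2Dsin2 sqrtr1. Qed.

Definition expi (R : realType) (t : R) : circle R :=
  exist _ ((cos t +i* sin t)%C : R[i]^o) (mem_set (normr_expi t)).

HB.instance Definition _ (R : realType) := Choice.on (circle R).
HB.instance Definition _ (R : realType) := isPointed.Build (circle R) (expi 0).
HB.instance Definition _ (R : realType) :=
  Topological.copy (circle R) (set_type [set z : R[i]^o | `|z| = 1]).

(* The Borel sigma-algebra of the circle. *)
HB.instance Definition _ (R : realType) :=
  @isMeasurable.Build (sigma_display (@open (circle R))) (circle R)
    <<s (@open (circle R)) >>
    (@sigma_algebra0 _ setT (@open (circle R)))
    (@sigma_algebraC _ (@open (circle R)))
    (@sigma_algebra_bigcup _ setT (@open (circle R))).

Section opuc.
Context {R : realType}.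
Implicit Types (rho : probability (circle R) R) (P : {poly R[i]}) (n : nat).

Definition msupport rho : set (circle R) :=
  [set z | forall U : set (circle R), open U -> U z -> (0 < rho U)%E].

Definition Cintegral rho (f : circle R -> R[i]) : R[i] :=
  ((\int[rho]_z complex.Re (f z)) +i* (\int[rho]_z complex.Im (f z)))%C.

Definition inner rho (f g : circle R -> R[i]) : R[i] :=
  Cintegral rho (fun z => (f z)^* * g z).

Definition norm2 rho (f : circle R -> R[i]) : R[i] := sqrtC (inner rho f f).

Definition on_circle P : circle R -> R[i] := fun z => P.[cval z].

Definition is_monic_OP rho n P : Prop :=
  [/\ P \is monic, size P = n.+1 &
      forall k, (k < n)%N -> inner rho (on_circle 'X^k) (on_circle P) = 0].

(* If the support of rho is infinite, exactly one polynomial satisfies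
   [is_monic_OP rho n]; the default value 0 is then irrelevant. *)
Definition Phi rho n : {poly R[i]} := xget 0 [set P | is_monic_OP rho n P].

Definition phi rho n : {poly R[i]} :=
  (norm2 rho (on_circle (Phi rho n)))^-1 *: Phi rho n.

(* z^n * conj (P (1 / conj z)) as a polynomial in z, for P of degree at most n;
   see [horner_reversed]. *)
Definition reversed n P : {poly R[i]} := \poly_(i < n.+1) (P`_(n - i))^*.

Lemma horner_reversed n P (z : R[i]) : (size P <= n.+1)%N -> z != 0 ->
  (reversed n P).[z] = z ^+ n * (P.[1 / z^*])^*.
Proof.
move=> sP z0; rewrite horner_poly (horner_coef_wide _ sP) rmorph_sum mulr_sumr.
rewrite (reindex_inj rev_ord_inj) /=; apply: eq_bigr => i _.
have le_in : (i <= n)%N by rewrite -ltnS.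
rewrite subSS subKn // rmorphM rmorphXn /= rmorphM rmorph1 mul1r fmorphV /= conjCK.
by rewrite mulrCA exprVn expfB_cond ?(negPf z0).
Qed.

Definition phi_star rho n : {poly R[i]} :=
  (norm2 rho (on_circle (Phi rho n)))^-1 *: reversed n (Phi rho n).

(* The Verblunsky coefficient: the unique solution of the Szego recursion. *)
Definition alpha rho n : R[i] :=
  xget 0 [set a : R[i] |
    Phi rho n.+1 = 'X * Phi rho n - a^* *: reversed n (Phi rho n)].

Definition K rho n (z : R[i]) : R[i] :=
  \sum_(0 <= j < n.+1) `|(phi rho j).[z]| ^+ 2.

End opuc.

(* Main.v *)
Require Import Defs.
From mathcomp Require Import all_boot all_order all_algebra.
From mathcomp Require Import complex.
From mathcomp Require Import all_classical all_reals all_analysis.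
From mathcomp Require Import measurable_realfun ring.

(** Write N_j for the squared norm of Phi_j in L^2(mu), K for K_n(zeta), and
    [k(z) = \sum_(j <= n) conj(phi_j(zeta)) phi_j(z)] for the
    Christoffel-Darboux kernel, which represents evaluation at zeta: <k, Q> =
    Q(zeta) for every Q of degree at most n. On polynomials, the inner product
    of nu is
      <P, Q>_nu = (1 - gamma) <P, Q>_mu + gamma conj(P(zeta)) Q(zeta),
    that is, up to scaling, that of mu plus a rank-one form, which k represents.
    Hence [Phi_(n+1)(mu) - c k] is, for every c, monic of degree
    n + 1, and its inner product with X^i (i <= n) in L^2(nu) is conj(zeta^i)
    times
      - (1 - gamma) c + gamma (Phi_(n+1)(zeta) - c K),
    which vanishes for [c = Phi_(n+1)(zeta) / ((1 - gamma) / gamma + K)]. This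
    is the polynomial Phi_(n+1)(nu) ([Phi_point_mass]).

    Evaluating at 0 gives the Verblunsky coefficients, since alpha_n =
    - conj(Phi_(n+1)(0)) ([alphaE]). The value k(0) is obtained from a second
    reproducing element: Phi_n^* / N_n represents evaluation at 0
    ([ip_reversed_eval0]), because reversal is an anti-unitary map of the
    polynomials of degree at most n which exchanges X^n and 1. So k(0) =
    conj(Phi_n^*(zeta)) / N_n ([CD_kernel_eval0]), and alpha_n(nu) - alpha_n(mu)
    = conj(c) Phi_n^*(zeta) / N_n. The square root in the formula is what
    normalizing Phi_(n+1) and Phi_n^* costs: N_(n+1) = (1 - |alpha_n|^2) N_n
    ([sqnormS]).

    The analysis is confined to two facts. Polynomials are bounded and
    measurable on the circle, so that all integrals converge and are linear. The
    form is positive definite on polynomials: a nonzero polynomial has finitely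
    many zeros, hence is nonzero at some point of an infinite support
    ([ip_gt0]); positivity passes from mu to nu. *)

Set Implicit Arguments.
Unset Strict Implicit.
Unset Printing Implicit Defensive.

Import Order.TTheory GRing.Theory Num.Theory.
Import numFieldNormedType.Exports.

Local Open Scope classical_set_scope.
Local Open Scope ring_scope.

(** * Integration of bounded measurable functions on the circle *)

Section Integration.
Context {R : realType}.
Implicit Types (rho : probability (circle R) R) (f g : circle R -> R[i]).
Implicit Types (x y : R[i]) (P Q : {poly R[i]}).

Lemma ReM x y : complex.Re (x * y) =
  complex.Re x * complex.Re y - complex.Im x * complex.Im y.
Proof. by case: x; case: y. Qed.

Lemma ImM x y : complex.Im (x * y) =
  complex.Re x * complex.Im y + complex.Im x * complex.Re y.
Proof. by case: x; case: y. Qed.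

Lemma ReD x y : complex.Re (x + y) = complex.Re x + complex.Re y.
Proof. by case: x; case: y. Qed.

Lemma ImD x y : complex.Im (x + y) = complex.Im x + complex.Im y.
Proof. by case: x; case: y. Qed.

Lemma Re_conj x : complex.Re x^* = complex.Re x.
Proof. by case: x. Qed.

Lemma Im_conj x : complex.Im x^* = - complex.Im x.
Proof. by case: x. Qed.

(** A class that is stable under the algebra operations and conjugation,
    contains the coordinate function, and on which [Cintegral] is linear. The
    real and imaginary parts are kept separate because [Cintegral] is. *)
Definition bounded_measurable f : Prop :=
  [/\ measurable_fun setT (fun z => complex.Re (f z)),
      measurable_fun setT (fun z => complex.Im (f z)) &
      exists M : R, forall z, `|f z| <= M%:C%C].

Lemma bounded_measurableD f g : bounded_measurable f -> bounded_measurable g ->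
  bounded_measurable (fun z => f z + g z).
Proof.
move=> [rf jf [M fM]] [rg jg [N gN]]; split.
- under eq_fun do rewrite ReD; exact: measurable_funD.
- under eq_fun do rewrite ImD; exact: measurable_funD.
- exists (M + N) => z; rewrite rmorphD /=.
  by apply: le_trans (ler_normD _ _) _; apply: lerD.
Qed.

Lemma bounded_measurableM f g : bounded_measurable f -> bounded_measurable g ->
  bounded_measurable (fun z => f z * g z).
Proof.
move=> [rf jf [M fM]] [rg jg [N gN]]; split.
- under eq_fun do rewrite ReM.
  by apply: measurable_funB; exact: measurable_funM.
- under eq_fun do rewrite ImM.
  by apply: measurable_funD; exact: measurable_funM.
- exists (M * N) => z; rewrite rmorphM /= normrM.
  by apply: ler_pM.
Qed.

Lemma bounded_measurable_conj f : bounded_measurable f ->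
  bounded_measurable (fun z => (f z)^*).
Proof.
move=> [rf jf [M fM]]; split.
- by under eq_fun do rewrite Re_conj.
- under eq_fun do rewrite Im_conj; exact: measurableT_comp.
- by exists M => z; rewrite norm_conjC.
Qed.

Lemma bounded_measurable_cst x : bounded_measurable (fun=> x).
Proof.
split; [exact: measurable_cst|exact: measurable_cst|].
by exists (complex.Re `|x|) => z; rewrite RRe_real // normr_real.
Qed.

Lemma circle_open_measurable (A : set (circle R)) : open A -> measurable A.
Proof. by move=> oA; apply: sub_sigma_algebra. Qed.

Lemma normr_cval (z : circle R) : `|cval z| = 1.
Proof. by case: z => z zP; have := set_mem zP. Qed.

Lemma cval_continuous : continuous (@cval R : circle R -> R[i]^o).
Proof. exact: initial_continuous. Qed.

(** This bound yields the continuity of both coordinates of the plane: a norm of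
    R[i] is itself an element of R[i], hence the embedding on the left. *)
Lemma plane_lipschitz_continuous (h : R[i]^o -> R) :
  (forall x y : R[i]^o, `|h x - h y|%:C%C <= `|x - y|) -> continuous h.
Proof.
move=> hL x A /nbhs_ballP[e e0 eA]; apply/nbhs_ballP.
exists e%:C%C; first by rewrite /= ltcR.
move=> y xy /=; apply: eA; rewrite /ball /= -ltcR.
exact: le_lt_trans (hL x y) xy.
Qed.

Lemma circle_continuous_measurable (h : circle R -> R) :
  continuous h -> measurable_fun setT h.
Proof.
move=> /continuousP ch; apply: (measurability _ (RGenOpens.measurableE R)).
move=> _ [_ [a [b ->] <-]]; rewrite setTI; apply: circle_open_measurable.
exact/ch/interval_open.
Qed.

Lemma norm_Im_le x : `|complex.Im x|%:C%C <= `|x|.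
Proof.
have := normc_ge_Re ('i%C * x); rewrite normrM ReM /= mul0r mul1r sub0r normrN.
by rewrite [`|'i%C|]normc_def /= expr0n expr1n add0r sqrtr1 mul1r.
Qed.

Lemma bounded_measurable_cval : bounded_measurable (@cval R).
Proof.
split; last by exists 1 => z; rewrite normr_cval.
- apply: circle_continuous_measurable => z.
  apply: (@continuous_comp _ _ _ (@cval R : circle R -> R[i]^o) (@complex.Re R)).
    exact: cval_continuous.
  apply: plane_lipschitz_continuous => x y.
  by rewrite (_ : _ - _ = complex.Re (x - y)) ?normc_ge_Re //; case: x; case: y.
- apply: circle_continuous_measurable => z.
  apply: (@continuous_comp _ _ _ (@cval R : circle R -> R[i]^o) (@complex.Im R)).
    exact: cval_continuous.
  apply: plane_lipschitz_continuous => x y.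
  by rewrite (_ : _ - _ = complex.Im (x - y)) ?norm_Im_le //; case: x; case: y.
Qed.

Lemma bounded_measurable_poly P : bounded_measurable (on_circle P).
Proof.
elim/poly_ind: P => [|P c IH].
  have -> : on_circle 0 = (fun=> 0 : R[i]) by apply/funext => z; exact: horner0.
  exact: bounded_measurable_cst.
have -> : on_circle (P * 'X + c%:P) = (fun z => on_circle P z * cval z + c).
  by apply/funext => z; exact: hornerMXaddC.
apply: bounded_measurableD; last exact: bounded_measurable_cst.
by apply: bounded_measurableM => //; exact: bounded_measurable_cval.
Qed.

Lemma integrable_bounded rho (h : circle R -> R) (M : R) :
  measurable_fun setT h -> (forall z, `|h z| <= M) ->
  rho.-integrable setT (EFin \o h).
Proof.
move=> mh hM; apply: measurable_bounded_integrable => //.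
  by apply: le_lt_trans (probability_le1 _ _) _ => //; exact: ltry.
exists M; split; first exact: num_real.
by move=> x Mx z _; apply: le_trans (hM z) (ltW Mx).
Qed.

Lemma integrable_Re rho f : bounded_measurable f ->
  rho.-integrable setT (EFin \o (fun z => complex.Re (f z))).
Proof.
move=> [mf _ [M fM]]; apply: (@integrable_bounded _ _ M) => // z.
by rewrite -lecR; apply: le_trans (normc_ge_Re _) (fM z).
Qed.

Lemma integrable_Im rho f : bounded_measurable f ->
  rho.-integrable setT (EFin \o (fun z => complex.Im (f z))).
Proof.
move=> [_ mf [M fM]]; apply: (@integrable_bounded _ _ M) => // z.
by rewrite -lecR; apply: le_trans (norm_Im_le _) (fM z).
Qed.

Lemma CintegralD rho f g : bounded_measurable f -> bounded_measurable g ->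
  Cintegral rho (fun z => f z + g z) = Cintegral rho f + Cintegral rho g.
Proof.
move=> bf bg; rewrite /Cintegral.
under eq_Rintegral do rewrite ReD.
rewrite RintegralD //; try exact: integrable_Re.
under [X in (_ +i* X)%C]eq_Rintegral do rewrite ImD.
by rewrite RintegralD //; exact: integrable_Im.
Qed.

Lemma CintegralZ rho f x : bounded_measurable f ->
  Cintegral rho (fun z => x * f z) = x * Cintegral rho f.
Proof.
move=> bf; have rf := integrable_Re rho bf; have jf := integrable_Im rho bf.
have Zi (h : circle R -> R) a : rho.-integrable setT (EFin \o h) ->
    rho.-integrable setT (EFin \o (fun z => a * h z)).
  move=> ih; have := integrableZl measurableT a ih.
  exact: (@eq_integrable _ _ _ rho setT measurableT).
case: x => a b; rewrite /Cintegral; apply/eqP; rewrite eq_complex /=; apply/andP; split.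
- under eq_Rintegral do rewrite ReM.
  rewrite RintegralB //=; try exact: Zi.
  by rewrite !RintegralZl.
- under eq_Rintegral do rewrite ImM.
  rewrite RintegralD //=; try exact: Zi.
  by rewrite !RintegralZl.
Qed.

Lemma Cintegral_conj rho f : bounded_measurable f ->
  Cintegral rho (fun z => (f z)^*) = (Cintegral rho f)^*.
Proof.
move=> bf; rewrite /Cintegral; apply/eqP; rewrite eq_complex /=; apply/andP; split.
  by apply/eqP; apply: eq_Rintegral => z _; rewrite Re_conj.
under eq_Rintegral do rewrite Im_conj -mulN1r.
by rewrite RintegralZl ?mulN1r //; exact: integrable_Im.
Qed.

End Integration.

(** * Integration against a measure with an added point mass *)

Section PointMass.
Context {R : realType}.
Variables (mu nu : probability (circle R) R) (gamma : R) (zeta : circle R).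
Hypotheses (gamma_ge0 : 0 <= gamma) (gamma_le1 : gamma <= 1).
Hypothesis nuE : forall A : set (circle R), measurable A ->
  nu A = ((1 - gamma)%:E * mu A + gamma%:E * \d_zeta A)%E.

Lemma integral_point_mass (h : circle R -> R) :
  measurable_fun setT h -> (forall z, 0 <= h z) ->
  (\int[nu]_z (h z)%:E =
   (1 - gamma)%:E * \int[mu]_z (h z)%:E + gamma%:E * (h zeta)%:E)%E.
Proof.
move=> mh h0; have g1 : 0 <= 1 - gamma by rewrite subr_ge0.
have mEh : measurable_fun setT (fun z => (h z)%:E) by exact/measurable_EFinP.
have h0E z : setT z -> (0 <= (h z)%:E)%E by rewrite lee_fin.
pose m1 : {measure set (circle R) -> \bar R} := mscale (NngNum g1) mu.
pose m2 : {measure set (circle R) -> \bar R} := mscale (NngNum gamma_ge0) (\d_zeta).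
have nu_add A : measurable A -> nu A = measure_add m1 m2 A.
  by move=> mA; rewrite nuE // measure_addE.
rewrite (@eq_measure_integral _ _ _ setT (measure_add m1 m2) nu); last first.
  by move=> A mA _; exact: nu_add.
rewrite ge0_integral_measure_add // !ge0_integral_mscale //.
by rewrite integral_dirac // diracT mul1e.
Qed.

(** Adding the constant M makes the integrand nonnegative, which reduces the
    claim to [integral_point_mass]; both sides change by M, because mu and nu
    are probability measures. *)
Lemma Rintegral_point_mass (h : circle R -> R) (M : R) :
  measurable_fun setT h -> (forall z, `|h z| <= M) ->
  \int[nu]_z h z = (1 - gamma) * \int[mu]_z h z + gamma * h zeta.
Proof.
move=> mh hM; pose k z := h z + M.
have mk : measurable_fun setT k by apply: measurable_funD.
have k0 z : 0 <= k z.
  by rewrite /k -lerBlDr sub0r; have := hM z; rewrite ler_norml => /andP[].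
have kM z : `|k z| <= M + M.
  rewrite ger0_norm // lerD2r; exact: le_trans (ler_norm _) (hM z).
have icst (rho : probability (circle R) R) : rho.-integrable setT (EFin \o cst M).
  by apply: (@integrable_bounded _ _ _ `|M|).
have intk (rho : probability (circle R) R) :
    \int[rho]_z k z = \int[rho]_z h z + M.
  rewrite RintegralD //; [|exact: integrable_bounded mh hM|exact: icst].
  rewrite Rintegral_cst // -[in RHS](mulr1 M); congr (_ + _ * _).
  exact: (congr1 fine (probability_setT rho)).
have finmu : (\int[mu]_z (k z)%:E)%E \is a fin_num.
  by apply: integrable_fin_num => //; exact: integrable_bounded mk kM.
have : \int[nu]_z k z = (1 - gamma) * \int[mu]_z k z + gamma * k zeta.
  rewrite /Rintegral integral_point_mass //.
  by rewrite fineD ?fineM // fin_numM.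
rewrite !intk /k => e; apply: (addIr M); rewrite e !mulrDr.
by rewrite addrACA -mulrDl subrK mul1r.
Qed.

Lemma Cintegral_point_mass (f : circle R -> R[i]) : bounded_measurable f ->
  Cintegral nu f = (1 - gamma)%:C%C * Cintegral mu f + gamma%:C%C * f zeta.
Proof.
move=> [rf jf [M fM]]; rewrite /Cintegral.
rewrite (@Rintegral_point_mass (fun z => complex.Re (f z)) M) //; last first.
  by move=> z; rewrite -lecR; apply: le_trans (normc_ge_Re _) (fM z).
rewrite (@Rintegral_point_mass (fun z => complex.Im (f z)) M) //; last first.
  by move=> z; rewrite -lecR; apply: le_trans (norm_Im_le _) (fM z).
apply/eqP; rewrite eq_complex; case: (f zeta) => a b /=.
by rewrite !mul0r !subr0 !addr0 !eqxx.
Qed.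

End PointMass.

(** * The inner product on polynomials *)

Section OrthogonalPolynomials.
Context {R : realType}.
Variable rho : probability (circle R) R.
Implicit Types (a x : R[i]) (P Q S : {poly R[i]}) (n k : nat).

Definition ip P Q : R[i] := inner rho (on_circle P) (on_circle Q).

Lemma bounded_measurable_ip P Q :
  bounded_measurable (fun z => (on_circle P z)^* * on_circle Q z).
Proof.
apply: bounded_measurableM; last exact: bounded_measurable_poly.
by apply: bounded_measurable_conj; exact: bounded_measurable_poly.
Qed.

Lemma ipDr P Q S : ip P (Q + S) = ip P Q + ip P S.
Proof.
rewrite /ip /inner -CintegralD; try exact: bounded_measurable_ip.
by congr Cintegral; apply/funext => z; rewrite /on_circle hornerD mulrDr.
Qed.

Lemma ipZr a P Q : ip P (a *: Q) = a * ip P Q.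
Proof.
rewrite /ip /inner -CintegralZ; last exact: bounded_measurable_ip.
by congr Cintegral; apply/funext => z; rewrite /on_circle hornerZ mulrCA.
Qed.

Lemma ip_conj P Q : (ip P Q)^* = ip Q P.
Proof.
rewrite /ip /inner -Cintegral_conj; last exact: bounded_measurable_ip.
by congr Cintegral; apply/funext => z; rewrite rmorphM /= conjCK mulrC.
Qed.

(** |z| = 1 on the circle. *)
Lemma ipMX P Q : ip ('X * P) ('X * Q) = ip P Q.
Proof.
rewrite /ip /inner; congr Cintegral; apply/funext => z.
rewrite /on_circle !hornerM !hornerX rmorphM /= mulrACA -normCKC normr_cval.
by rewrite expr1n mul1r.
Qed.

Lemma ip_self P : ip P P = (\int[rho]_z complex.Re (`|on_circle P z| ^+ 2))%:C%C.
Proof.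
rewrite /ip /inner /Cintegral -complexr0; congr (_ +i* _)%C.
  by apply: eq_Rintegral => z _; rewrite normCKC.
transitivity (\int[rho]_z (0 : R)); last by rewrite Rintegral_cst // mul0r.
by apply: eq_Rintegral => z _; rewrite -normCKC normc_def -rmorphXn.
Qed.

Lemma ip_ge0 P : 0 <= ip P P.
Proof.
rewrite ip_self ler0c; apply: Rintegral_ge0 => z _.
by rewrite normc_def -rmorphXn /= sqr_ge0.
Qed.

Lemma cval_inj : injective (@cval R).
Proof. exact: val_inj. Qed.

Lemma closed_finite_plane (s : seq R[i]) : @closed R[i]^o [set x | x \in s].
Proof.
have /accessible_finite_set_closed : accessible_space R[i]^o.
  exact/hausdorff_accessible/norm_hausdorff.
apply; exact: finite_seq.
Qed.

(** If the integral of |P|^2 vanishes, then P = 0 outside a null set. But P is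
    nonzero on the complement of a finite set, which is open and contains a
    point of the infinite support, and so has positive measure. *)
Lemma ip_gt0 P : infinite_set (msupport rho) -> P != 0 -> 0 < ip P P.
Proof.
move=> supp_rho P0; rewrite lt_neqAle ip_ge0 andbT eq_sym; apply/negP => /eqP.
have [s Ps] := closed_field_poly_normal P.
have rootP (z : circle R) : (P.[cval z] == 0) = (cval z \in s).
  by rewrite {1}Ps -rootE rootZ ?lead_coef_eq0 // root_prod_XsubC.
pose Z : set (circle R) := @cval R @^-1` [set x | x \in s].
have finZ : finite_set Z.
  apply: finite_preimage; last exact: finite_seq.
  by move=> x y _ _; exact: cval_inj.
have [z [suppz NZz]] := infinite_setN0 (infinite_setD supp_rho finZ).
have openZ : open (~` Z).
  have /continuousP cv := @cval_continuous R.
  by rewrite /Z preimage_setC; apply: cv; rewrite openC; exact: closed_finite_plane.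
have := suppz _ openZ NZz.
pose h z := complex.Re (`|on_circle P z| ^+ 2).
have hE w : h w = complex.Re ((on_circle P w)^* * on_circle P w).
  by rewrite /h normCKC.
have inth : rho.-integrable setT (EFin \o h).
  rewrite (_ : h = fun z => complex.Re ((on_circle P z)^* * on_circle P z)).
    by apply: integrable_Re; exact: bounded_measurable_ip.
  exact/funext.
have h0 w : 0 <= h w by rewrite /h normc_def -rmorphXn /= sqr_ge0.
rewrite ip_self => posZ /complexI int0.
have : (\int[rho]_z `|(EFin \o h) z| = 0)%E.
  under eq_integral do rewrite /= ger0_norm //.
  have /fineK <- := integrable_fin_num measurableT inth; exact: (congr1 EFin int0).
move/(ae_eq_integral_abs _ measurableT (measurable_int _ inth)) => [N [mN N0 sub]].
suff : (rho (~` Z) <= rho N)%E by rewrite N0 leNgt posZ.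
apply: le_measure; rewrite ?inE //; first exact: circle_open_measurable.
move=> w Zw; apply: sub => /(_ I) /= -[hw0]; apply: Zw; rewrite /Z /= -rootP.
have /RRe_real e : `|on_circle P w| ^+ 2 \is Num.real by rewrite rpredX ?normr_real.
by move: e; rewrite -/(h w) hw0 => /esym/eqP; rewrite sqrf_eq0 normr_eq0.
Qed.

Lemma ipDl P Q S : ip (P + Q) S = ip P S + ip Q S.
Proof. by rewrite -ip_conj ipDr rmorphD /= !ip_conj. Qed.

Lemma ipZl a P Q : ip (a *: P) Q = a^* * ip P Q.
Proof. by rewrite -ip_conj ipZr rmorphM /= ip_conj. Qed.

Lemma ip0r P : ip P 0 = 0.
Proof. by rewrite -(scale0r 0) ipZr mul0r. Qed.

Lemma ip0l P : ip 0 P = 0.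
Proof. by rewrite -ip_conj ip0r rmorph0. Qed.

Lemma ipNr P Q : ip P (- Q) = - ip P Q.
Proof. by rewrite -scaleN1r ipZr mulN1r. Qed.

Lemma ipBr P Q S : ip P (Q - S) = ip P Q - ip P S.
Proof. by rewrite ipDr ipNr. Qed.

(** * Reversal and monic orthogonal polynomials *)

Lemma size_reversed n P : (size (reversed n P) <= n.+1)%N.
Proof. exact: size_poly. Qed.

Lemma coef_reversed n P k : (k <= n)%N -> (reversed n P)`_k = (P`_(n - k))^*.
Proof. by move=> kn; rewrite coef_poly ltnS kn. Qed.

Lemma reversedK n P : (size P <= n.+1)%N -> reversed n (reversed n P) = P.
Proof.
move=> sP; apply/polyP => k; case: (leqP k n) => kn.
  by rewrite coef_reversed // coef_reversed ?leq_subr // subKn // conjCK.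
by rewrite !nth_default // (leq_trans _ kn) // size_reversed.
Qed.

(** On the circle 1 / conj z = z. *)
Lemma horner_reversed_circle n P (z : circle R) : (size P <= n.+1)%N ->
  (reversed n P).[cval z] = cval z ^+ n * (P.[cval z])^*.
Proof.
move=> sP; have z0 : cval z != 0 by rewrite -normr_eq0 normr_cval oner_eq0.
rewrite horner_reversed // div1r; congr (_ * P.[_]^*).
apply: (mulIf (x := (cval z)^*)); first by rewrite conjC_eq0.
by rewrite mulVf ?conjC_eq0 // -normCK normr_cval expr1n.
Qed.

(** Reversal is anti-unitary: on the circle it multiplies the conjugate of P by
    z^n, which has modulus 1. *)
Lemma ip_reversed n P Q : (size P <= n.+1)%N -> (size Q <= n.+1)%N ->
  ip (reversed n P) (reversed n Q) = ip Q P.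
Proof.
move=> sP sQ; rewrite /ip /inner; congr Cintegral; apply/funext => z.
rewrite /on_circle !horner_reversed_circle // rmorphM /= conjCK mulrACA.
by rewrite -normCKC normrX normr_cval !expr1n mul1r mulrC.
Qed.

Lemma ip_lower n P Q : is_monic_OP rho n P -> (size Q <= n)%N -> ip Q P = 0.
Proof.
move=> [_ _ orthP] sQ.
rewrite -[Q]coefK poly_def; elim/big_rec: _ => [|i S _ IH]; first exact: ip0l.
by rewrite ipDl ipZl IH addr0 [ip _ P]orthP ?mulr0 // (leq_trans _ sQ).
Qed.

Lemma coef_lead n P : is_monic_OP rho n P -> P`_n = 1.
Proof. by move=> [/monicP + sP _]; rewrite lead_coefE sP. Qed.

Lemma size_drop_lead n P : (size P <= n.+1)%N -> P`_n = 0 -> (size P <= n)%N.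
Proof.
move=> sP Pn; apply/leq_sizeP => j; rewrite leq_eqVlt => /predU1P[<- //|nj].
by rewrite nth_default // (leq_trans sP).
Qed.

Lemma size_sub_leading n P Q : is_monic_OP rho n P -> (size Q <= n.+1)%N ->
  (size (Q - Q`_n *: P)%R <= n)%N.
Proof.
move=> opP sQ; have [_ sP _] := opP.
apply: size_drop_lead; last by rewrite coefB coefZ (coef_lead opP) mulr1 subrr.
rewrite (leq_trans (size_polyD _ _)) // size_polyN geq_max sQ.
by rewrite (leq_trans (size_scale_leq _ _)) // sP.
Qed.

Lemma ip_leading n P Q : is_monic_OP rho n P -> (size Q <= n.+1)%N ->
  ip Q P = (Q`_n)^* * ip P P.
Proof.
move=> opP sQ.
rewrite -{1}(subrK (Q`_n *: P) Q) ipDl ipZl (ip_lower opP) ?add0r //.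
exact: size_sub_leading.
Qed.

(** The reversed orthogonal polynomial represents, up to the factor <P, P>, the
    evaluation at 0: reversal turns the constant coefficient of Q into a leading
    coefficient, which [ip_leading] reads off. *)
Lemma ip_reversed_eval0 n P Q : is_monic_OP rho n P -> (size Q <= n.+1)%N ->
  ip (reversed n P) Q = Q.[0] * ip P P.
Proof.
move=> opP sQ; have [_ sP _] := opP.
rewrite -{1}(reversedK sQ) ip_reversed ?size_reversed ?sP //.
by rewrite (ip_leading opP) ?size_reversed // coef_reversed // subnn conjCK horner_coef0.
Qed.

(** * Szego recursion and Verblunsky coefficients *)

Hypothesis ip_pos : forall P, P != 0 -> 0 < ip P P.

Lemma ip_eq0 P : ip P P = 0 -> P = 0.
Proof.
move=> P0; apply/eqP; apply: contraTT isT => /ip_pos.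
by rewrite P0 ltxx.
Qed.

Lemma monic_OP_unique n P Q : is_monic_OP rho n P -> is_monic_OP rho n Q -> P = Q.
Proof.
move=> opP opQ; apply/eqP; rewrite -subr_eq0; apply/eqP/ip_eq0.
have [_ sP _] := opP.
have sPQ : (size (P - Q)%R <= n)%N.
  rewrite -[Q]scale1r -(coef_lead opP); apply: size_sub_leading opQ _.
  by rewrite sP.
by rewrite ipBr (ip_lower opP) // (ip_lower opQ) // subrr.
Qed.

Lemma monic_OP_gt0 n P : is_monic_OP rho n P -> 0 < ip P P.
Proof. by move=> [mP _ _]; apply/ip_pos/monic_neq0. Qed.

(** X P is orthogonal to X, ..., X^n by invariance under multiplication by X,
    and so is the reversed polynomial by [ip_reversed_eval0]; subtracting a
    multiple of the latter restores orthogonality to 1. This gives at once the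
    existence of the orthogonal polynomials and the Szego recursion. *)
Lemma monic_OP_szego n P : is_monic_OP rho n P ->
  is_monic_OP rho n.+1 ('X * P - (ip 1 ('X * P) / ip P P) *: reversed n P).
Proof.
move=> opP; have [mP sP orthP] := opP; have P0 := monic_neq0 mP.
set a := _ / _.
have sXP : size ('X * P) = n.+2 by rewrite mulrC size_mulX ?sP.
have sR : (size (- (a *: reversed n P))%R < n.+2)%N.
  by rewrite size_polyN ltnS (leq_trans (size_scale_leq _ _)) // size_reversed.
split.
- by rewrite monicE lead_coefDl ?sXP // -monicE monicMl // monicX.
- by rewrite size_polyDl sXP.
move=> [_|k kn]; rewrite -/(ip _ _) ipBr ipZr -[ip _ (reversed _ _)]ip_conj.
  rewrite expr0 (ip_reversed_eval0 opP) ?size_poly1 // hornerC mul1r ip_conj.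
  by rewrite divfK ?subrr // gt_eqF // (monic_OP_gt0 opP).
rewrite (ip_reversed_eval0 opP) ?size_polyXn // exprS hornerM hornerX !mul0r.
by rewrite rmorph0 mulr0 subr0 ipMX; apply: orthP.
Qed.

Lemma monic_OP_exists n : exists P, is_monic_OP rho n P.
Proof.
elim: n => [|n [P opP]]; last by eexists; exact: monic_OP_szego opP.
by exists 1; split; rewrite ?monic1 ?size_poly1.
Qed.

Lemma PhiP n : is_monic_OP rho n (Phi rho n).
Proof. by exact: (xgetPex 0 (monic_OP_exists n)). Qed.

Lemma Phi_unique n P : is_monic_OP rho n P -> Phi rho n = P.
Proof. exact/monic_OP_unique/PhiP. Qed.

Lemma size_Phi n : size (Phi rho n) = n.+1.
Proof. by have [] := PhiP n. Qed.

Definition sqnorm n : R[i] := ip (Phi rho n) (Phi rho n).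

Lemma sqnorm_gt0 n : 0 < sqnorm n.
Proof. exact/monic_OP_gt0/PhiP. Qed.

Lemma sqnorm_neq0 n : sqnorm n != 0.
Proof. by rewrite gt_eqF // sqnorm_gt0. Qed.

Lemma szego_recursion n :
  Phi rho n.+1 = 'X * Phi rho n - (alpha rho n)^* *: reversed n (Phi rho n).
Proof.
set c := ip 1 ('X * Phi rho n) / sqnorm n.
have rec : Phi rho n.+1 = 'X * Phi rho n - (c^*)^* *: reversed n (Phi rho n).
  by rewrite conjCK; apply/Phi_unique/monic_OP_szego/PhiP.
suff : [set a : R[i] | Phi rho n.+1 =
    'X * Phi rho n - a^* *: reversed n (Phi rho n)] (alpha rho n) by [].
by apply: xgetPex; exists c^*.
Qed.

Lemma alphaE n : alpha rho n = - ((Phi rho n.+1).[0])^*.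
Proof.
rewrite szego_recursion hornerD hornerN hornerM hornerX mul0r add0r hornerZ.
rewrite horner_coef0 coef_reversed // subn0 (coef_lead (PhiP n)).
by rewrite rmorph1 mulr1 rmorphN /= conjCK opprK.
Qed.

(** In X Phi_n = Phi_(n+1) + conj(alpha_n) Phi_n^* the two terms on the right
    are orthogonal, and the norms of X Phi_n and Phi_n^* equal that of Phi_n:
    this is Pythagoras' theorem. *)
Lemma sqnormS n : sqnorm n.+1 = (1 - `|alpha rho n| ^+ 2) * sqnorm n.
Proof.
set S := reversed n (Phi rho n); set a := alpha rho n.
have sS : (size S <= n.+1)%N := size_reversed _ _.
have SP : ip S (Phi rho n.+1) = 0 := ip_lower (PhiP n.+1) sS.
have XP : 'X * Phi rho n = Phi rho n.+1 + a^* *: S.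
  by rewrite szego_recursion subrK.
have : ip ('X * Phi rho n) ('X * Phi rho n) = sqnorm n by rewrite ipMX.
rewrite XP ipDl !ipDr !ipZl !ipZr -[ip (Phi _ _) S]ip_conj SP rmorph0 !mulr0.
rewrite add0r addr0 conjCK ip_reversed ?size_Phi // mulrA -normCK -!/(sqnorm _).
by move=> e; apply/esym; rewrite mulrBl mul1r -{1}e addrK.
Qed.

(** * The Christoffel-Darboux kernel *)

(** The kernel of degree less than n, as a polynomial in its second argument. It
    is written with the monic polynomials, whose squared norms avoid square
    roots. *)
Definition CD_kernel n x : {poly R[i]} :=
  \sum_(j < n) ((Phi rho j).[x]^* / sqnorm j) *: Phi rho j.

Lemma size_CD_kernel n x : (size (CD_kernel n x) <= n)%N.
Proof.
apply: (leq_trans (size_sum _ _ _)); apply/bigmax_leqP => j _.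
by rewrite (leq_trans (size_scale_leq _ _)) // size_Phi.
Qed.

Lemma CD_kernel_reproducing n x Q : (size Q <= n)%N -> ip (CD_kernel n x) Q = Q.[x].
Proof.
elim: n Q => [|n IH] Q sQ.
  by move: sQ; rewrite leqn0 size_poly_eq0 => /eqP->; rewrite ip0r horner0.
have opP := PhiP n; set q := Q`_n.
have sS := size_sub_leading opP sQ; rewrite -/q in sS.
rewrite -(subrK (q *: Phi rho n) Q); move: (Q - _) sS => S sS.
rewrite /CD_kernel big_ord_recr /= -/(CD_kernel n x) ipDl !ipDr !ipZr !ipZl IH //.
rewrite (ip_lower opP) ?size_CD_kernel // -[ip (Phi _ _) S]ip_conj (ip_lower opP sS).
rewrite rmorph0 !mulr0 addr0 add0r rmorphM /= conjCK fmorphV /= ip_conj.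
rewrite divfK ?sqnorm_neq0 //.
by rewrite hornerD hornerZ.
Qed.

(** Pairing the kernel at x with the reversed Phi_n evaluates the latter at x;
    pairing in the other order evaluates the kernel at 0, by
    [ip_reversed_eval0]. *)
Lemma CD_kernel_eval0 n x :
  (CD_kernel n.+1 x).[0] = ((reversed n (Phi rho n)).[x])^* / sqnorm n.
Proof.
apply: (mulIf (sqnorm_neq0 n)); rewrite divfK ?sqnorm_neq0 //.
rewrite -(ip_reversed_eval0 (PhiP n)) ?size_CD_kernel // -ip_conj.
by rewrite CD_kernel_reproducing ?size_reversed.
Qed.

Lemma norm2_Phi n : norm2 rho (on_circle (Phi rho n)) = sqrtC (sqnorm n).
Proof. by []. Qed.

Lemma CD_kernel_diagonal n x : (CD_kernel n.+1 x).[x] = K rho n x.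
Proof.
rewrite /K big_mkord /CD_kernel horner_sum; apply: eq_bigr => j _.
have N0 : 0 <= sqrtC (sqnorm j) by rewrite sqrtC_ge0 ltW ?sqnorm_gt0.
rewrite hornerZ /phi hornerZ norm2_Phi normrM normfV (ger0_norm N0) exprMn exprVn.
by rewrite sqrtCK normCKC mulrAC mulrC.
Qed.

Lemma sqrt_szego n :
  sqrtC (1 - `|alpha rho n| ^+ 2) = sqrtC (sqnorm n.+1) / sqrtC (sqnorm n).
Proof.
rewrite sqnormS sqrtCM ?mulfK ?sqrtC_eq0 ?sqnorm_neq0 //.
  by rewrite nnegrE -(pmulr_lge0 _ (sqnorm_gt0 n)) -sqnormS ltW ?sqnorm_gt0.
by rewrite nnegrE ltW ?sqnorm_gt0.
Qed.

End OrthogonalPolynomials.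

(** * Adding a point mass *)

Section AddPointMass.
Context {R : realType}.
Variables (mu nu : probability (circle R) R) (gamma : R) (zeta : circle R).
Hypotheses (gamma_gt0 : 0 < gamma) (gamma_lt1 : gamma < 1).
Hypothesis nuE : forall A : set (circle R), measurable A ->
  nu A = ((1 - gamma)%:E * mu A + gamma%:E * \d_zeta A)%E.
Hypothesis mu_pos : forall P, P != 0 -> 0 < ip mu P P.
Let z := cval zeta.

Lemma ip_point_mass P Q : ip nu P Q =
  (1 - gamma)%:C%C * ip mu P Q + gamma%:C%C * ((P.[z])^* * Q.[z]).
Proof.
apply: (Cintegral_point_mass (ltW gamma_gt0) (ltW gamma_lt1) nuE).
exact: bounded_measurable_ip.
Qed.

Lemma ip_gt0_point_mass P : P != 0 -> 0 < ip nu P P.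
Proof.
move=> P0; rewrite ip_point_mass ltr_wpDr //.
  apply: mulr_ge0; first by rewrite ler0c ltW.
  by rewrite -normCKC exprn_ge0.
by rewrite mulr_gt0 ?mu_pos // ltcR subr_gt0.
Qed.

Lemma point_mass_denominator_gt0 n :
  0 < ((1 - gamma) * gamma^-1)%:C%C + K mu n z.
Proof.
rewrite ltr_wpDr //; last by rewrite ltcR mulr_gt0 ?invr_gt0 ?subr_gt0.
by rewrite /K; apply: sumr_ge0 => j _; rewrite exprn_ge0.
Qed.

(** The kernel represents evaluation at zeta, so subtracting a multiple c of it
    from Phi_(n+1) can cancel the contribution of the point mass to all the
    inner products with 1, ..., X^n simultaneously. *)
Lemma Phi_point_mass n :
  Phi nu n.+1 = Phi mu n.+1 -
    ((Phi mu n.+1).[z] / (((1 - gamma) * gamma^-1)%:C%C + K mu n z))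
      *: CD_kernel mu n.+1 z.
Proof.
set D := _ + K mu n z; set c := _ / D.
have D0 : D != 0 by rewrite gt_eqF // point_mass_denominator_gt0.
have opP := PhiP mu_pos n.+1; have [mP sP _] := opP.
have sk : (size (- (c *: CD_kernel mu n.+1 z))%R < n.+2)%N.
  by rewrite size_polyN ltnS (leq_trans (size_scale_leq _ _)) // size_CD_kernel.
apply: (Phi_unique ip_gt0_point_mass); split.
- by rewrite monicE lead_coefDl ?sP // -monicE.
- by rewrite size_polyDl sP.
move=> k kn; rewrite -/(ip _ _ _) ip_point_mass.
have sX : (size ('X^k : {poly R[i]}) <= n.+1)%N by rewrite size_polyXn.
rewrite ipBr ipZr (ip_lower opP sX) -[ip _ _ (CD_kernel _ _ _)]ip_conj.
rewrite (CD_kernel_reproducing mu_pos) // hornerD hornerN hornerZ.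
rewrite (CD_kernel_diagonal mu_pos).
rewrite sub0r mulrCA -[X in _ + X]mulrCA.
set w := ('X^k.[z])^*.
have -> : (Phi mu n.+1).[z] = c * D by rewrite divfK.
(* With these substitutions both terms carry the factor gamma * c * (D - K). *)
have -> : (1 - gamma)%:C%C = gamma%:C%C * (D - K mu n z).
  by rewrite /D addrK -rmorphM /= mulrCA divff ?mulr1 // gt_eqF.
ring.
Qed.

End AddPointMass.

Theorem theorem1p1 (R : realType) (mu : probability (circle R) R)
  (supp_mu : infinite_set (msupport mu))
  (gamma : R) (gamma_gt0 : 0 < gamma) (gamma_lt1 : gamma < 1)
  (omega : R) (zeta : circle R) (zetaE : zeta = expi omega)
  (nu : probability (circle R) R)
  (nuE : forall A : set (circle R), measurable A ->
    nu A = ((1 - gamma)%:E * mu A + gamma%:E * \d_zeta A)%E)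
  (n : nat) :
  alpha nu n = alpha mu n
    + sqrtC (1 - `|alpha mu n| ^+ 2)
      / (((1 - gamma) * gamma^-1)%:C%C + K mu n (cval zeta))
      * ((phi mu n.+1).[cval zeta])^* * (phi_star mu n).[cval zeta].
Proof.
have mu_pos P : P != 0 -> 0 < ip mu P P by exact: ip_gt0.
have nu_pos := ip_gt0_point_mass gamma_gt0 gamma_lt1 nuE mu_pos.
rewrite (sqrt_szego mu_pos) (alphaE nu_pos).
rewrite (Phi_point_mass gamma_gt0 gamma_lt1 nuE mu_pos).
rewrite hornerD hornerN hornerZ (CD_kernel_eval0 mu_pos) rmorphB /= opprB addrC.
rewrite (alphaE mu_pos); congr (_ + _).
rewrite /phi /phi_star !hornerZ !norm2_Phi.
set D := _ + K mu n _.
have D0 : 0 < D by exact: point_mass_denominator_gt0.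
have sqrtN_gt0 m : 0 < sqrtC (sqnorm mu m) by rewrite sqrtC_gt0 sqnorm_gt0.
set s := sqrtC (sqnorm mu n); set t := sqrtC (sqnorm mu n.+1).
have s_gt0 : 0 < s := sqrtN_gt0 n; have t_gt0 : 0 < t := sqrtN_gt0 n.+1.
have -> : sqnorm mu n = s ^+ 2 by rewrite sqrtCK.
rewrite !rmorphM /= conjCK !fmorphV /= rmorphXn /=.
rewrite (conj_Creal (gtr0_real D0)) (conj_Creal (gtr0_real s_gt0)).
rewrite (conj_Creal (gtr0_real t_gt0)).
by field; rewrite !gt_eqF.
Qed.
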